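(* Let $\alpha \in (0,1)$ and $\delta \in (0,1)$, and define $$\gamma_n(\delta) := \frac{4 \log \frac{1}{\delta}}{3n} + \sqrt{\Big(\frac{4}{3n}\log\frac{1}{\delta}\Big)^2 + \frac{2\alpha(1-\alpha)}{n}\log\frac{1}{\delta}} \;\le\; \frac{8\log\frac1\delta}{3n} + \sqrt{\frac{2\alpha(1-\alpha)}{n}\log\frac1\delta}.$$ Then with probability at least $1-\delta$ over the draw of the sample $P_n$, $$1-\alpha-\gamma_n(\delta) \le \mathbb{P}\big(Y_{n+1} \in \widehat{C}_n(X_{n+1}) \mid P_n\big).$$ If additionally the scores $S_i = s(X_i,Y_i)$ have a density, then with probability at least $1-2\delta$, $$1-\alpha-\gamma_n(\delta) \le \mathbb{P}\big(Y_{n+1} \in \widehat{C}_n(X_{n+1}) \mid P_n\big) \le 1-\alpha+\gamma_n(\delta).$$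
   Context: Let $(X_i,Y_i)_{i=1}^{n+1}$ be i.i.d. from a distribution $P$ on $\mathcal{X}\times\mathcal{Y}$, let $s:\mathcal{X}\times\mathcal{Y}\to\mathbb{R}$ be a fixed (measurable) scoring function, and set $S_i = s(X_i,Y_i)$. $P_n$ denotes the empirical distribution of $(X_i,Y_i)_{i=1}^n$ (equivalently, the sample itself); conditioning on $P_n$ means conditioning on the first $n$ observations, and $P_n(S\le t) = \frac1n\sum_{i=1}^n \mathbf{1}\{S_i \le t\}$. The empirical quantile is $\widehat\tau_n := \inf\{t\in\mathbb{R} : P_n(S\le t)\ge 1-\alpha\}$ and the confidence set is $\widehat{C}_n(x) := \{y\in\mathcal{Y} : s(x,y)\le \widehat\tau_n\}$. *)

(* Defs.v *)
From HB Require Import structures.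
From mathcomp Require Import all_boot all_order all_algebra.
From mathcomp Require Import all_classical all_reals all_analysis.
Set Implicit Arguments.
Unset Strict Implicit.
Unset Printing Implicit Defensive.
Import Order.TTheory GRing.Theory Num.Theory.
Import numFieldNormedType.Exports.
Local Open Scope classical_set_scope.
Local Open Scope ring_scope.

(* Finite families only: taking some of the B i to be setT gives the product
   rule for every subfamily. *)
Definition mutually_independent d d' (T : measurableType d)
    (T' : measurableType d') (R : realType) (Pr : probability T R)
    (I : finType) (Z : I -> T -> T') : Prop :=
  forall B : I -> set T', (forall i, measurable (B i)) ->
    Pr (\bigcap_i (Z i @^-1` B i)) = (\prod_(i : I) Pr (Z i @^-1` B i))%E.

Definition identically_distributed d d' (T : measurableType d)
    (T' : measurableType d') (R : realType) (Pr : probability T R)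
    (I : finType) (Z : I -> T -> T') (P : probability T' R) : Prop :=
  forall (i : I) (B : set T'), measurable B -> pushforward Pr (Z i) B = P B.

Definition iid d d' (T : measurableType d)
    (T' : measurableType d') (R : realType) (Pr : probability T R)
    (I : finType) (Z : I -> T -> T') (P : probability T' R) : Prop :=
  mutually_independent Pr Z /\ identically_distributed Pr Z P.

(* A conditional probability given the sigma-algebra G is only determined up to
   a Pr-null set, so it is a relation: g is one version of Pr(A | G). *)
Definition is_cond_prob d (T : measurableType d) (R : realType)
    (Pr : probability T R) (G : set (set T)) (A : set T) (g : T -> R) : Prop :=
  [/\ preimage_set_system setT g measurable `<=` G,
      Pr.-integrable setT (EFin \o g) &
      forall B, G B -> (\int[Pr]_(w in B) (g w)%:E)%E = Pr (A `&` B)].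

Definition has_density (R : realType) (nu : set R -> \bar R) : Prop :=
  exists f : R -> R,
    [/\ measurable_fun setT f, forall t, 0 <= f t &
        forall A, measurable A ->
          nu A = (\int[lebesgue_measure]_(t in A) (f t)%:E)%E].

Definition empirical (R : realType) (T : Type) (n : nat) (z : 'I_n -> T)
    (A : set T) : R :=
  n%:R^-1 * \sum_(i < n) \1_A (z i).

(* For 0 < n and 0 < alpha < 1 the set is nonempty and bounded below, so inf is
   the true infimum (inf is 0 otherwise). *)
Definition emp_quantile (R : realType) (T : Type) (n : nat) (s : T -> R)
    (alpha : R) (z : 'I_n -> T) : R :=
  inf [set t : R | 1 - alpha <= empirical R z [set p | s p <= t]].

Definition conf_set (R : realType) (TX TY : Type) (n : nat)
    (s : TX * TY -> R) (alpha : R) (z : 'I_n -> TX * TY) (x : TX) : set TY :=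
  [set y | s (x, y) <= emp_quantile s alpha z].

Definition gamma_n (R : realType) (n : nat) (alpha delta : R) : R :=
  4 * ln (1 / delta) / (3 * n%:R)
  + Num.sqrt ((4 / (3 * n%:R) * ln (1 / delta)) ^+ 2
              + 2 * alpha * (1 - alpha) / n%:R * ln (1 / delta)).

(* In a family indexed by 'I_n.+1, the first n members are the sample and the
   member at ord_max is the test point. *)
Definition first_n (T : Type) (n : nat) (z : 'I_n.+1 -> T) : 'I_n -> T :=
  fun i => z (widen_ord (leqnSn n) i).

(* Main.v *)
(** Fix q = 1 - alpha - gamma and let t be a q-quantile of the score law, so
that P(S <= t) >= q and P(S < t) <= q.  If P_n(S < t) < 1 - alpha then the
empirical quantile is at least t, and independence of the test point from the
sample makes the conditional coverage at least P(S <= t) >= q.  The exceptional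
event { P_n(S < t) >= 1 - alpha } is an upper deviation by gamma of a binomial
frequency with mean at most q; gamma is chosen so that Bernstein's inequality
bounds its probability by delta.  The upper bound is the mirror image, with the
quantile at 1 - alpha + gamma and the event { P_n(S > t) >= alpha }; there the
absence of atoms is what gives P(S <= t) <= 1 - alpha + gamma.

Since t is deterministic, only the independence of the test point from events of
the sample sigma-algebra is needed, and no disintegration. *)

Require Import Defs.
From HB Require Import structures.
From mathcomp Require Import all_boot all_order all_algebra.
From mathcomp Require Import all_classical all_reals all_analysis.
From mathcomp Require Import ring lra.
Set Implicit Arguments.
Unset Strict Implicit.
Unset Printing Implicit Defensive.
Import Order.TTheory GRing.Theory Num.Theory.
Import numFieldNormedType.Exports.
Local Open Scope classical_set_scope.
Local Open Scope ring_scope.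

(** * Bernstein's bound and the radius [gamma_n] *)

(** Each exponential inequality below compares an auxiliary function with its value at 0. *)
Lemma le_of_derive_ge0 (R : realType) (f df : R -> R) :
  (forall x : R, is_derive x 1 f (df x)) ->
  (forall x, 0 <= x -> 0 <= df x) -> forall x, 0 <= x -> f 0 <= f x.
Proof.
move=> fdf df0 x x0.
apply: (@ger0_derive1_ndecry _ f 0) => //.
- by move=> y; rewrite in_itv/= andbT => /ltW /df0; rewrite derive1E derive_val.
- apply: continuous_subspaceT => y; apply: differentiable_continuous.
  by apply/derivable1_diffP.
Qed.

Lemma expR_ge_quad (R : realType) (x : R) : 0 <= x ->
  1 + x + x ^+ 2 / 2 <= expR x.
Proof.
move=> x0.
have := @le_of_derive_ge0 _ (fun y : R => expR y - (1 + y + y ^+ 2 / 2))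
  (fun y => expR y - (1 + y)) _ _ x x0.
rewrite expR0 => h; suff : 0 <= expR x - (1 + x + x ^+ 2 / 2) by lra.
apply: le_trans (h _ _); first by lra.
- by move=> y; apply: is_derive_eq; rewrite /GRing.scale/=; lra.
- by move=> y _; have := expR_ge1Dx y; lra.
Qed.

Lemma expR_le_quad_npos (R : realType) (x : R) : x <= 0 ->
  expR x <= 1 + x + x ^+ 2 / 2.
Proof.
move=> x0; have y0 : 0 <= - x by lra.
(* Multiplying by [expR y], with y = -x, leaves a single nonnegative term in the derivative. *)
have := @le_of_derive_ge0 _ (fun y : R => expR y * (1 - y + y ^+ 2 / 2))
  (fun y => expR y * (y ^+ 2 / 2)) _ _ _ y0.
rewrite expR0 => h.
have : 1 <= expR (- x) * (1 + x + x ^+ 2 / 2).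
  rewrite (_ : 1 + x + _ = 1 - - x + (- x) ^+ 2 / 2); last by ring.
  apply: le_trans (h _ _); first by lra.
  + by move=> y; apply: is_derive_eq; rewrite /GRing.scale/=; lra.
  + by move=> y _; rewrite mulr_ge0 ?expR_ge0// divr_ge0 ?sqr_ge0.
by rewrite expRN mulrC ler_pdivlMr ?expR_gt0// mul1r.
Qed.

(* The right-hand side is the [2/1] Pade approximant of the exponential. *)
Lemma expR_le_pade (R : realType) (x : R) : 0 <= x < 3 ->
  expR x <= 1 + x + x ^+ 2 / (2 * (1 - x / 3)).
Proof.
move=> /andP[x0 x3].
(* The claim is multiplied by [expR (- x)] and by 6 - 2x, positive since x < 3; the sign of the
   derivative then comes from [expR_ge_quad]. *)
have := @le_of_derive_ge0 _
  (fun y : R => expR (- y) * (6 + 4 * y + y ^+ 2) - (6 - 2 * y))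
  (fun y => 2 - 2 * (expR (- y) * (1 + y + y ^+ 2 / 2))) _ _ _ x0.
rewrite oppr0 expR0 => h.
have : 6 - 2 * x <= expR (- x) * (6 + 4 * x + x ^+ 2).
  rewrite -subr_ge0; apply: le_trans (h _ _); first by lra.
  - by move=> y; apply: is_derive_eq; rewrite /GRing.scale/=; lra.
  - move=> y y0.
    suff : expR (- y) * (1 + y + y ^+ 2 / 2) <= 1 by lra.
    by rewrite expRN mulrC ler_pdivrMr ?expR_gt0// mul1r expR_ge_quad.
rewrite [expR _ * _]mulrC expRN ler_pdivlMr ?expR_gt0// => k.
have d0 : 6 - 2 * x != 0 by apply/eqP; lra.
have -> : 1 + x + x ^+ 2 / (2 * (1 - x / 3)) = (6 + 4 * x + x ^+ 2) / (6 - 2 * x).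
  by field; apply/andP; split; apply/eqP; lra.
by rewrite ler_pdivlMr; lra.
Qed.

(** Pointwise inequality behind Bernstein's bound, with one quadratic coefficient for all
    [x <= lam]: the denominator at [lam] is at most the Pade one for x in [0, lam], and at most 2
    for x < 0. *)
Lemma expR_le_bernstein (R : realType) (lam x : R) : 0 <= lam < 3 -> x <= lam ->
  expR x <= 1 + x + x ^+ 2 / (2 * (1 - lam / 3)).
Proof.
move=> /andP[l0 l3] xl.
have mono (c c' : R) : 0 < c' -> c' <= c -> x ^+ 2 / c <= x ^+ 2 / c'.
  move=> c0 cc; apply: ler_wpM2l; first exact: sqr_ge0.
  by rewrite lef_pV2 ?posrE//; exact: lt_le_trans cc.
have [x0|x0] := leP 0 x.
- apply: le_trans (expR_le_pade _) _; first by lra.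
  by rewrite lerD2l; apply: mono; lra.
- apply: le_trans (expR_le_quad_npos _) _; first by lra.
  by rewrite lerD2l; apply: mono; lra.
Qed.

(** A centred Bernoulli variable takes the values -p and 1 - p. Averaging [expR_le_bernstein] over
    them cancels the linear terms and leaves the variance p (1 - p); then 1 + u <= exp u. *)
Lemma bernoulli_mgf_le (R : realType) (p lam : R) :
  0 <= p <= 1 -> 0 <= lam < 3 ->
  1 - p + p * expR lam
  <= expR (lam * p + p * (1 - p) * lam ^+ 2 / (2 * (1 - lam / 3))).
Proof.
move=> /andP[p0 p1] l03; have /andP[l0 l3] := l03.
have lp0 : 0 <= lam * p by rewrite mulr_ge0.
have lp1 : lam * p <= lam by rewrite ler_piMr.
have h0 := @expR_le_bernstein _ lam (- (lam * p)) l03.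
have h1 := @expR_le_bernstein _ lam (lam * (1 - p)) l03.
have {}h0 := h0 ltac:(lra); have {}h1 := h1 ltac:(lra).
set c := 2 * (1 - lam / 3) in h0 h1 *.
have c0 : c != 0 by rewrite /c; apply/eqP; lra.
have : (1 - p) * expR (- (lam * p)) + p * expR (lam * (1 - p))
   <= expR (p * (1 - p) * lam ^+ 2 / c).
  apply: le_trans (expR_ge1Dx _).
  apply: (le_trans (lerD (ler_wpM2l _ h0) (ler_wpM2l _ h1))) => //; first by lra.
  by rewrite le_eqVlt; apply/orP; left; apply/eqP; field.
rewrite expRD -ler_pdivrMl ?expR_gt0// -expRN => {}h.
apply: le_trans h; rewrite mulrBr mulr1 expRD expRN.
by rewrite le_eqVlt; apply/orP; left; apply/eqP; ring.
Qed.

(* [gamma_n] is the positive root of the quadratic that makes Bernstein's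
   exponent equal to [ln (1 / delta)]. *)
Lemma gamma_n_root (R : realType) (n : nat) (alpha delta : R) : (0 < n)%N ->
  0 < alpha < 1 -> 0 < delta < 1 ->
  let g := gamma_n n alpha delta in let L := ln (1 / delta) in
  0 < g /\ n%:R * g ^+ 2 = 2 * L * (alpha * (1 - alpha) + 4 / 3 * g).
Proof.
move=> n0 /andP[a0 a1] /andP[d0 d1] g L.
have L0 : 0 < L by rewrite ln_gt0// ltr_pdivlMr// mul1r.
have N0 : 0 < n%:R :> R by rewrite ltr0n.
have Nn : n%:R != 0 :> R by rewrite gt_eqF.
rewrite /g /gamma_n -/L.
set A := 4 / (3 * n%:R) * L; set B := 2 * alpha * (1 - alpha) / n%:R * L.
have A0 : 0 < A by rewrite mulr_gt0// divr_gt0// mulr_gt0.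
have B0 : 0 < B by rewrite mulr_gt0// divr_gt0// mulr_gt0//; lra.
have -> : 4 * L / (3 * n%:R) = A by rewrite /A; field.
set r := Num.sqrt _.
have r2 : r ^+ 2 = A ^+ 2 + B by rewrite sqr_sqrtr// addr_ge0 ?sqr_ge0// ltW.
split; first by rewrite ltr_wpDr ?sqrtr_ge0.
have -> : (A + r) ^+ 2 = 2 * A * (A + r) + B by rewrite sqrrD r2; ring.
by rewrite {1}/A /B; field.
Qed.

(** This is sqrt (A^2 + B) <= A + sqrt B; the extra A turns the 4 into 8. *)
Lemma gamma_n_le (R : realType) (n : nat) (alpha delta : R) : (0 < n)%N ->
  0 < alpha < 1 -> 0 < delta < 1 ->
  gamma_n n alpha delta <= 8 * ln (1 / delta) / (3 * n%:R)
           + Num.sqrt (2 * alpha * (1 - alpha) / n%:R * ln (1 / delta)).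
Proof.
move=> n0 /andP[a0 a1] /andP[d0 d1].
have L0 : 0 < ln (1 / delta) by rewrite ln_gt0// ltr_pdivlMr// mul1r.
have N0 : 0 < n%:R :> R by rewrite ltr0n.
rewrite /gamma_n; set L := ln _ in L0 *.
set A := 4 / (3 * n%:R) * L; set B := 2 * alpha * (1 - alpha) / n%:R * L.
have A0 : 0 < A by rewrite mulr_gt0// divr_gt0// mulr_gt0.
have B0 : 0 < B by rewrite mulr_gt0// divr_gt0// mulr_gt0//; lra.
have -> : 4 * L / (3 * n%:R) = A by rewrite /A; field; rewrite gt_eqF.
have -> : 8 * L / (3 * n%:R) = A + A by rewrite /A; field; rewrite gt_eqF.
rewrite -addrA lerD2l.
have s0 := sqrtr_ge0 B.
rewrite -[leRHS]ger0_norm ?addr_ge0 ?(ltW A0)// -sqrtr_sqr.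
apply: ler_wsqrtr; rewrite sqrrD (sqr_sqrtr (ltW B0))//.
have : 0 <= A * Num.sqrt B by rewrite mulr_ge0// ltW.
by lra.
Qed.

(** Lets the upper coverage bound reuse the deviation estimate with [alpha] and [1 - alpha]
    exchanged. *)
Lemma gamma_nC (R : realType) (n : nat) (alpha delta : R) :
  gamma_n n (1 - alpha) delta = gamma_n n alpha delta.
Proof.
by rewrite /gamma_n (_ : 2 * (1 - alpha) * _ = 2 * alpha * (1 - alpha)); last ring.
Qed.

Lemma bernstein_chernoff_le (R : realType) (n : nat) (alpha delta p : R) :
  (0 < n)%N -> 0 < alpha < 1 -> 0 < delta < 1 ->
  0 <= p <= 1 - alpha - gamma_n n alpha delta ->
  exists2 lam : R, 0 <= lam &
    (1 - p + p * expR lam) ^+ n * expR (- lam * (n%:R * (1 - alpha))) <= delta.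
Proof.
move=> n0 a01 d01 /andP[p0 pg].
have [g0 groot] := gamma_n_root n0 a01 d01.
move: a01 d01 => /andP[a0 a1] /andP[d0 d1].
set g := gamma_n n alpha delta in pg g0 groot *; set L := ln _ in groot.
have L0 : 0 < L by rewrite ln_gt0// ltr_pdivlMr// mul1r.
have N0 : 0 < n%:R :> R by rewrite ltr0n.
have dE : delta = expR (- L).
  by rewrite expRN lnK ?invrK ?posrE ?divr_gt0// div1r invrK.
(* At p = 0 the moment generating function is 1, and [lam] is chosen to make the bound exactly
   [delta]. The other case then has q >= p > 0. *)
have [->|pn0] := eqVneq p 0.
  exists (L / (n%:R * (1 - alpha))).
    by rewrite ltW// divr_gt0// mulr_gt0//; lra.
  rewrite subr0 mul0r addr0 expr1n mul1r dE ler_expR mulNr divfK//.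
  by apply/eqP => /eqP; rewrite mulf_eq0 => /orP[]/eqP; lra.
(* The extreme mean [q] replaces [p]: the bound increases with the mean, and the deviation from [q]
   to 1 - alpha is exactly [g]. *)
pose q : R := 1 - alpha - g.
have q0 : 0 < q by rewrite (lt_le_trans _ pg)// lt_neqAle eq_sym pn0.
have q1 : q < 1 by rewrite /q; lra.
pose v : R := q * (1 - q).
have v0 : 0 < v by rewrite mulr_gt0//; lra.
(* Passing from the variance at [q] to the one at [alpha] costs at most [g]; with Bernstein's g / 3
   this makes the 4 / 3 of [gamma_n_root]. *)
have vle : v <= alpha * (1 - alpha) + g.
  by rewrite /v /q; nra.
have vg : 0 < v + g / 3 by rewrite addr_gt0// divr_gt0.
(* Bernstein's choice: 1 - lam / 3 = v / (v + g / 3), so the variance term collapses to lam * g /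
   2. *)
pose lam := g / (v + g / 3).
have lam0 : 0 < lam by rewrite divr_gt0.
have lam3 : lam < 3 by rewrite ltr_pdivrMr//; lra.
exists lam; first exact: ltW.
have mono : 1 - p + p * expR lam <= 1 - q + q * expR lam.
  have : 1 <= expR lam by rewrite (le_trans _ (expR_ge1Dx _))// lerDl ltW.
  move=> e1; have : 0 <= (q - p) * (expR lam - 1) by rewrite mulr_ge0 ?subr_ge0.
  by lra.
have mgf := @bernoulli_mgf_le _ q lam ltac:(lra) ltac:(lra).
have e0 := expR_ge0 lam.
have b0 : 0 <= 1 - p + p * expR lam by rewrite addr_ge0 ?mulr_ge0//; lra.
have /(_ n) powle : forall k, (1 - p + p * expR lam) ^+ k <=
    expR (lam * q + lam * g / 2) ^+ k.
  move=> k; apply: lerXn2r; rewrite ?nnegrE ?expR_ge0//.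
  apply: (le_trans mono); apply: (le_trans mgf); rewrite -/v ler_expR lerD2l.
  rewrite le_eqVlt; apply/orP; left; apply/eqP.
  rewrite /lam; field; apply/andP; split; apply/eqP; lra.
apply: (le_trans (ler_wpM2r (expR_ge0 _) powle)).
rewrite -expRM_natl -expRD.
rewrite dE ler_expR.
have -> : n%:R * (lam * q + lam * g / 2) + - lam * (n%:R * (1 - alpha))
    = - (n%:R * g ^+ 2 / (v + g / 3) / 2).
  by rewrite /lam /q; field; apply/eqP; lra.
rewrite lerN2 ler_pdivlMr// ler_pdivlMr// groot.
have : L * v <= L * (alpha * (1 - alpha) + g) by rewrite ler_wpM2l// ltW.
by lra.
Qed.

(** * Population and empirical quantiles *)

Lemma inf_lt (R : realType) (A : set R) (u : R) :
  has_inf A -> inf A < u -> exists2 t, A t & t < u.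
Proof.
move=> hA Au; have := inf_adherent _ hA.
move=> /(_ (u - inf A)); rewrite subr_gt0 => /(_ Au)[t At].
by rewrite addrC subrK; exists t.
Qed.

(** Take for t the infimum of the points where the distribution function reaches [q]; its limits at
    the infinities make the infimum genuine. Right continuity gives the first inequality, continuity
    from below the second. *)
Lemma quantile_exists d (T : measurableType d) (R : realType)
    (P : probability T R) (X : {RV P >-> R}) (q : R) : 0 < q < 1 ->
  exists t : R, (q%:E <= P (X @^-1` `]-oo, t]) /\
                 P (X @^-1` `]-oo, t[) <= q%:E)%E.
Proof.
move=> /andP[q0 q1].
pose A := [set t : R | (q%:E <= cdf X t)%E].
have A0 : A !=set0.
  apply: contrapT => /set0P/negP; rewrite negbK => /eqP A0.
  have : (1 <= q%:E)%E; last by rewrite lee_fin leNgt q1.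
  apply: (cvge_le _ (cvg_cdfy1 X)); near=> t; rewrite leNgt; apply/negP => /ltW At.
  by have : A t by []; rewrite A0.
have lbA : has_lbound A.
  apply: contrapT => nlb.
  have : (q%:E <= 0)%E; last by rewrite lee_fin leNgt q0.
  apply: (cvge_ge _ (cvg_cdfNy0 X)); near=> t; rewrite leNgt; apply/negP => At.
  apply: nlb; exists t => u /= Au; rewrite leNgt; apply/negP => ut.
  have := le_trans Au (cdf_nondecreasing X (ltW ut)).
  by rewrite leNgt At.
exists (inf A); split.
- have rc := @cdf_right_continuous _ _ _ _ X (inf A).
  apply: (cvge_ge _ rc); near=> r.
  have Ar : inf A < r by near: r; exact: nbhs_right_gt.
  have [a Aa ar] := inf_lt (conj A0 lbA) Ar.
  by apply: le_trans Aa _; exact/cdf_nondecreasing/ltW.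
(* Closed half-lines ending strictly before [inf A] exhaust the open one, and each has mass below
   [q]. *)
- pose F k := X @^-1` `]-oo, (inf A - k.+1%:R^-1)%R].
  have mF k : measurable (F k) by exact: measurable_funPTI.
  have -> : X @^-1` `]-oo, inf A[ = \bigcup_k F k.
    rewrite /F -preimage_bigcup; congr (_ @^-1` _); apply/seteqP; split => x /=.
      rewrite in_itv/= => xA; exists (Num.truncn (inf A - x)^-1) => //=.
      rewrite in_itv/= lerBrDr -lerBrDl invf_ple ?posrE ?subr_gt0//.
      exact/ltW/truncnS_gt.
    move=> [k _] /=; rewrite !in_itv/= => /le_lt_trans; apply.
    by rewrite ltrBlDr ltrDl.
  have cF : P (F k) @[k --> \oo] --> P (\bigcup_k F k).
    apply: nondecreasing_cvg_mu => //; first exact: bigcup_measurable.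
    move=> m k mk; apply/subsetPset; apply: preimage_subset; apply: subset_itvl.
    by rewrite bnd_simp lerD2l lerN2 lef_pV2 ?posrE// ler_nat.
  apply: (cvge_le _ cF); near=> k; rewrite leNgt; apply/negP => /ltW Ak.
  have : inf A <= inf A - k.+1%:R^-1 by apply: ge_inf.
  by rewrite lerDl oppr_ge0 leNgt invr_gt0 ltr0n.
Unshelve. all: by end_near. Qed.

Section empirical.
Context (R : realType) (T : Type) (n : nat).
Implicit Types (z : 'I_n -> T) (A B : set T) (s : T -> R).

Lemma empirical_sub z A B : A `<=` B -> empirical R z A <= empirical R z B.
Proof.
move=> AB; rewrite /empirical ler_wpM2l ?invr_ge0//.
apply: ler_sum => i _; rewrite !indicE ler_nat.
by have [/set_mem/AB/mem_set ->|] := boolP (z i \in A).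
Qed.

Lemma empirical_setC z A : (0 < n)%N ->
  empirical R z (~` A) = 1 - empirical R z A.
Proof.
move=> n0; have N0 : n%:R != 0 :> R by rewrite pnatr_eq0 -lt0n.
rewrite /empirical; apply: (mulfI N0); rewrite mulrBr !mulVKf// mulr1.
apply/eqP; rewrite eq_sym subr_eq -big_split/=; apply/eqP.
rewrite (eq_bigr (fun=> 1)) ?sumr_const ?card_ord//= => i _.
by rewrite !indicE in_setC; case: (z i \in A); rewrite ?addr0 ?add0r.
Qed.

(** Boolean patterns range over a finite type, which allows sums and unions over all of them
    later. *)
Lemma empiricalP z A (b : {ffun 'I_n -> bool}) :
  (forall i, A (z i) <-> b i) ->
  empirical R z A = n%:R^-1 * \sum_i (b i)%:R.
Proof.
move=> Ab; congr (_ * _); apply: eq_bigr => i _; rewrite indicE; congr (_%:R).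
by congr nat_of_bool; apply/idP/idP; rewrite inE => /Ab.
Qed.

Lemma emp_quantile_has_inf s (alpha : R) z : (0 < n)%N -> 0 < alpha < 1 ->
  has_inf [set t : R | 1 - alpha <= empirical R z [set p | s p <= t]].
Proof.
move=> n0 /andP[a0 a1]; have N0 : n%:R != 0 :> R by rewrite pnatr_eq0 -lt0n.
split.
(* The sum of the absolute scores dominates every score: the frequency is 1 there, and 0 strictly
   below its opposite. *)
- exists (\sum_i `|s (z i)|) => /=.
  rewrite (@empiricalP _ _ [ffun=> true]).
    under eq_bigr => i _ do rewrite ffunE.
    by rewrite sumr_const card_ord mulVf//; lra.
  move=> i; rewrite ffunE; split => // _ /=.
  rewrite (bigD1 i)//= (le_trans (ler_norm _))// lerDl.
  by apply: sumr_ge0.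
- exists (- \sum_i `|s (z i)|) => t /= ht; rewrite leNgt; apply/negP => tlt.
  move: ht; rewrite leNgt => /negP; apply; rewrite (@empiricalP _ _ [ffun=> false]).
    by rewrite big1 ?mulr0; [lra|move=> i _; rewrite ffunE].
  move=> i; rewrite ffunE; split => //= st.
  have := le_lt_trans st tlt; rewrite ltNge => /negP[].
  rewrite lerNl (le_trans (ler_norm _))// normrN (bigD1 i)//= lerDl.
  by apply: sumr_ge0.
Qed.

Lemma emp_quantile_le s (alpha t : R) z : (0 < n)%N -> 0 < alpha < 1 ->
  1 - alpha <= empirical R z [set p | s p <= t] -> emp_quantile s alpha z <= t.
Proof.
move=> n0 a01 ht; apply: ge_inf => //.
by have [] := emp_quantile_has_inf s z n0 a01.
Qed.

(** Both sides can be strict because the scores are finitely many: for t just below u, a sample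
    score is below u exactly when it is at most t. *)
Lemma emp_quantile_lt s (alpha u : R) z : (0 < n)%N -> 0 < alpha < 1 ->
  emp_quantile s alpha z < u <-> 1 - alpha <= empirical R z [set p | s p < u].
Proof.
move=> n0 a01; have hi := emp_quantile_has_inf s z n0 a01.
split=> [/(inf_lt hi) [t /= ht tu]|h].
  by apply: (le_trans ht); apply: empirical_sub => p /= /le_lt_trans; apply.
have : \forall t \near u^'-, forall i, s (z i) < u -> s (z i) <= t.
  apply: filter_forall => i; have [siu|] := ltP (s (z i)) u; last first.
    by move=> _; near=> t.
  by near=> t => _; near: t; exact: nbhs_left_ge.
move=> ht; near u^'- => t.
have tu : t < u by near: t; exact: nbhs_left_lt.
apply: le_lt_trans tu; apply: emp_quantile_le => //.
apply: (le_trans h); rewrite /empirical ler_wpM2l ?invr_ge0//.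
apply: ler_sum => i _; rewrite !indicE ler_nat.
have [|//] := boolP (_ \in [set p | s p < u]) => /set_mem /= siu.
suff -> : z i \in [set p | s p <= t] by [].
by apply/mem_set => /=; apply: (near ht t) => //.
Unshelve. all: by end_near. Qed.
End empirical.

(** * Binomial deviations *)

Lemma measure_bigsetU_le d (T : ringOfSetsType d) (R : realFieldType)
    (mu : {content set T -> \bar R}) (I : Type) (r : seq I) (Q : pred I)
    (F : I -> set T) : (forall i, measurable (F i)) ->
  (mu (\big[setU/set0]_(i <- r | Q i) F i) <= \sum_(i <- r | Q i) mu (F i))%E.
Proof.
move=> mF; elim: r => [|i r IH]; first by rewrite !big_nil measure0.
rewrite !big_cons; case: ifP => // Qi.
by apply: le_trans (measureU2 _ _ _) (leeD2l _ IH) => //; exact: bigsetU_measurable.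
Qed.

Section empirical_deviation.
Context (R : realType) (n : nat).

(** The pattern [b] prescribes which indices fall in [V]; one set per index is the form required by
    [mutually_independent]. *)
Definition indicator_pattern (T' : Type) (V : set T') (b : {ffun 'I_n -> bool})
    (i : 'I_n) : set T' := if b i then V else ~` V.

Lemma empirical_ge_bigcup (Omega T' : Type) (Z : 'I_n -> Omega -> T')
    (V : set T') (a : R) :
  [set w | a <= empirical R (Z ^~ w) V] =
  \bigcup_(b in [set` [pred b : {ffun 'I_n -> bool} |
                        a <= n%:R^-1 * \sum_i (b i)%:R]])
    \bigcap_i (Z i @^-1` indicator_pattern V b i).
Proof.
apply/seteqP; split => w /=.
  move=> aw; exists [ffun i => Z i w \in V] => /=; last first.
    move=> i _; rewrite /indicator_pattern ffunE /=.
    by case: ifPn => [/set_mem|/negP nV Vw] //; apply: nV; apply/mem_set.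
  rewrite inE/= -(@empiricalP _ _ _ (Z^~ w) V)// => i; rewrite ffunE.
  by split => [/mem_set|/set_mem].
move=> [b /= ab Hb]; rewrite (@empiricalP _ _ _ (Z^~ w) V b)// => i.
have := Hb i I; rewrite /indicator_pattern /=.
by case: (b i) => // nV; split.
Qed.

Lemma empirical_ge_measurable d (Omega : measurableType d) (T' : Type)
    (Z : 'I_n -> Omega -> T') (V : set T') (a : R) :
  (forall i, measurable (Z i @^-1` V)) ->
  measurable [set w | a <= empirical R (Z ^~ w) V].
Proof.
move=> mZ; rewrite empirical_ge_bigcup bigcup_pred.
apply: bigsetU_measurable => b _; apply: fin_bigcap_measurable.
  exact: finite_finset.
move=> i _; rewrite /indicator_pattern; case: ifP => // _.
exact: (measurableC (mZ i)).
Qed.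

Context d d' (Omega : measurableType d) (T' : measurableType d').
Context (Pr : probability Omega R) (P : probability T' R).
Context (Z : 'I_n -> Omega -> T').
Hypothesis mZ : forall i, measurable_fun setT (Z i).
Hypothesis Ziid : iid Pr Z P.

(** Chernoff's argument as a finite sum over patterns: each cell has a product weight, and where the
    frequency is at least [a] the tilt exp (lam (k - n a)), with k the number of hits, is at least
    1. *)
Lemma empirical_chernoff (V : set T') (a lam p : R) : measurable V ->
  P V = p%:E -> (0 < n)%N -> 0 <= lam ->
  (Pr [set w | (a <= empirical R (Z ^~ w) V)%R] <=
   ((1 - p + p * expR lam) ^+ n * expR (- lam * (n%:R * a)))%:E)%E.
Proof.
move=> mV pE n0 lam0.
have p0 : 0 <= p by rewrite -lee_fin -pE.
have p1 : p <= 1 by rewrite -lee_fin -pE probability_le1.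
have mpat b i : measurable (indicator_pattern V b i).
  by rewrite /indicator_pattern; case: ifP => // _; exact: measurableC.
pose wt (c : bool) := if c then p else 1 - p.
have wt0 c : 0 <= wt c by rewrite /wt; case: c; rewrite ?subr_ge0.
have Prcell b : Pr (\bigcap_i (Z i @^-1` indicator_pattern V b i))
    = (\prod_i wt (b i))%:E.
  rewrite (Ziid.1 _ (mpat b)) -prodEFin; apply: eq_bigr => i _.
  rewrite [LHS](Ziid.2 i _ (mpat b i)) /indicator_pattern /wt.
  by case: (b i) => //; rewrite probability_setC// pE.
rewrite empirical_ge_bigcup bigcup_pred.
apply: (le_trans (measure_bigsetU_le _ _ _ _)).
  move=> b; apply: fin_bigcap_measurable; first exact: finite_finset.
  by move=> i _; rewrite -[X in measurable X]setTI; exact: mZ.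
rewrite (eq_bigr _ (fun b _ => Prcell b)).
rewrite sumEFin lee_fin.
(* Distributivity expands the n-th power into a sum over all patterns. *)
have -> : (1 - p + p * expR lam) ^+ n =
    \sum_(b : {ffun 'I_n -> bool}) \prod_i (wt (b i) * expR (lam * (b i)%:R)).
  rewrite -(bigA_distr_bigA (fun _ c => wt c * expR (lam * c%:R))).
  rewrite big_const card_ord iter_mulr_1; congr (_ ^+ _).
  by rewrite big_bool /wt mulr1 mulr0 expR0 mulr1 addrC.
(* Patterns below the threshold contribute only nonnegative terms on the right. *)
rewrite mulr_suml big_mkcond/=; apply: ler_sum => b _.
case: ifPn => [|_]; last first.
  by rewrite mulr_ge0 ?expR_ge0//; apply: prodr_ge0 => i _; rewrite mulr_ge0 ?expR_ge0.
rewrite inE => ab.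
rewrite big_split/= -expR_sum -mulrA -expRD ler_peMr//.
  by apply: prodr_ge0.
rewrite -mulr_sumr mulNr -mulrBr -[leLHS](expR0 R) ler_expR mulr_ge0// subr_ge0.
by rewrite -ler_pdivlMl ?ltr0n.
Qed.

Lemma empirical_bernstein (V : set T') (alpha delta : R) : measurable V ->
  (0 < n)%N -> 0 < alpha < 1 -> 0 < delta < 1 ->
  (P V <= (1 - alpha - gamma_n n alpha delta)%:E)%E ->
  (Pr [set w | (1 - alpha <= empirical R (Z ^~ w) V)%R] <= delta%:E)%E.
Proof.
move=> mV n0 a01 d01 PV.
have pE : P V = (fine (P V))%:E by rewrite fineK// fin_num_measure.
have [] := @bernstein_chernoff_le R n alpha delta (fine (P V)) n0 a01 d01.
  by rewrite -!lee_fin -pE PV measure_ge0.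
move=> lam lam0 lamd.
apply: le_trans (empirical_chernoff _ mV pE n0 lam0) _.
by rewrite lee_fin.
Qed.

End empirical_deviation.

(** * Independence of the sample and the test point *)

Section sample_and_test_point.
Context d d' (R : realType) (Omega : measurableType d) (T' : measurableType d').
Context (Pr : probability Omega R) (P : probability T' R) (n : nat).
Context (Z : 'I_n.+1 -> Omega -> T').
Hypothesis mZ : forall i, measurable_fun setT (Z i).
Hypothesis Ziid : iid Pr Z P.

Let measurable_preimage i W : measurable W -> measurable (Z i @^-1` W).
Proof. by move=> mW; rewrite -[X in measurable X]setTI; exact: mZ. Qed.

Let first_n_last_prod (B : 'I_n -> set T') (W : set T') :
  (forall i, measurable (B i)) -> measurable W ->
  Pr ((\bigcap_i (first_n Z i @^-1` B i)) `&` (Z ord_max @^-1` W)) =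
  ((\prod_i Pr (first_n Z i @^-1` B i)) * Pr (Z ord_max @^-1` W))%E.
Proof.
move=> mB mW.
(* [insub] fails only at [ord_max], so the default [W] is used exactly at the test point. *)
pose B' (j : 'I_n.+1) := if insub (val j) is Some i then B i else W.
have B'w i : B' (widen_ord (leqnSn n) i) = B i.
  by rewrite /B' /= (valK i).
have B'm : B' ord_max = W by rewrite /B' insubF//= ltnn.
have mB' j : measurable (B' j) by rewrite /B'; case: insub.
have := Ziid.1 B' mB'; rewrite big_ord_recr/= B'm.
under eq_bigr => i _ do rewrite B'w.
move=> <-; congr (Pr _); apply/seteqP; split => w /=.
  move=> [Bw Ww] j _ /=; rewrite /B'.
  case: insubP => [i _ ij|].
    have -> : j = widen_ord (leqnSn n) i by exact/val_inj/esym.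
    exact: Bw.
  rewrite -leqNgt => nj; suff -> : j = ord_max by [].
  by apply/val_inj/eqP; rewrite eqn_leq nj -ltnS ltn_ord.
move=> Bw; split; last by have := Bw ord_max I; rewrite /= B'm.
by move=> i _ /=; have := Bw (widen_ord (leqnSn n) i) I; rewrite /= B'w.
Qed.

Lemma iid_first_n : iid Pr (first_n Z) P.
Proof.
split=> [B mB|i B mB]; last exact: (Ziid.2 (widen_ord (leqnSn n) i)).
have := first_n_last_prod mB measurableT.
by rewrite preimage_setT setIT probability_setT mule1.
Qed.

Lemma g_sigma_preimage_first_n_measurable :
  g_sigma_preimage (first_n Z) `<=` measurable.
Proof.
apply: smallest_sub; first exact: sigma_algebra_measurable.
apply: (big_ind (fun U : set (set Omega) => U `<=` measurable)) => //.
- by move=> U V hU hV A [/hU|/hV].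
- by move=> i _ A [B mB <-]; rewrite setTI; exact: measurable_preimage.
Qed.

(** Pi-lambda argument: boxes over the sample are stable under intersection and generate the sample
    sigma-algebra, while the events obeying the product rule with a fixed test event form a
    lambda-system. *)
Lemma g_sigma_preimage_first_n_independent (B : set Omega) (W : set T') :
  g_sigma_preimage (first_n Z) B -> measurable W ->
  Pr (B `&` (Z ord_max @^-1` W)) = (Pr B * Pr (Z ord_max @^-1` W))%E.
Proof.
move=> GB mW; set C := Z ord_max @^-1` W.
have mC : measurable C by exact: measurable_preimage.
pose box (B : 'I_n -> set T') := \bigcap_i (first_n Z i @^-1` B i).
pose U := [set A | exists2 B : 'I_n -> set T',
             (forall i, measurable (B i)) & A = box B].
pose H := [set A | measurable A /\ Pr (A `&` C) = (Pr A * Pr C)%E].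
have mbox B' : (forall i, measurable (B' i)) -> measurable (box B').
  move=> mB'; apply: fin_bigcap_measurable; first exact: finite_finset.
  by move=> i _; exact: measurable_preimage.
suff : <<s U >> `<=` H.
  move=> sUH; suff /sUH [] : <<s U >> B by [].
  move: B GB; apply: smallest_sub; first exact: smallest_sigma_algebra.
  apply: (big_ind (fun V : set (set Omega) => V `<=` <<s U >>)) => //.
    by move=> V1 V2 h1 h2 A [/h1|/h2].
  move=> i _ A [D mD <-]; rewrite setTI; apply: sub_sigma_algebra.
  (* A one-coordinate event is a box whose other sides are full. *)
  exists (fun j => if j == i then D else setT).
    by move=> j; case: ifP.
  apply/seteqP; split => w /= Hw; last by have := Hw i I; rewrite /= eqxx.
  by move=> j _ /=; case: eqP => [->|].
apply: lambda_system_subset => //.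
- move=> _ _ [B1 mB1 ->] [B2 mB2 ->]; exists (fun i => B1 i `&` B2 i).
    by move=> i; exact: measurableI.
  by rewrite /box bigcapI.
- apply/dynkin_lambda_system; split.
  + by split => //; rewrite setTI probability_setT mul1e.
  + move=> A [mA HA]; split; first exact: measurableC.
    have -> : ~` A `&` C = C `\` (A `&` C) by rewrite setDIr setDv setU0 setDE setIC.
    transitivity (Pr C - Pr (A `&` C))%E.
      rewrite measureD//; first by rewrite setICA setIid.
        exact: measurableI.
      by rewrite ltey_eq fin_num_measure.
    rewrite HA probability_setC// muleBl ?mul1e//.
      exact: fin_num_measure.
  + move=> F tF HF; have mF k : measurable (F k) by case: (HF k).
    split; first exact: bigcup_measurable.
    transitivity (\sum_(0 <= k <oo) Pr (F k `&` C))%E.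
      rewrite setI_bigcupl measure_bigcup.
      - by apply: eq_eseriesl => k; rewrite in_setT.
      - by move=> k _; exact: measurableI.
      - exact: trivIset_setIr.
    transitivity ((\sum_(0 <= k <oo) Pr (F k)) * Pr C)%E; last first.
      congr (_ * _)%E; rewrite measure_bigcup//.
      by apply: eq_eseriesl => k; rewrite in_setT.
    have CE : Pr C = (fine (Pr C))%:E by rewrite fineK// fin_num_measure.
    rewrite muleC CE -nneseriesZl//.
    by apply: eq_eseriesr => k _; rewrite (HF k).2 CE muleC.
- move=> _ [B' mB' ->]; split; first exact: mbox.
  by rewrite first_n_last_prod// -iid_first_n.1.
Qed.

End sample_and_test_point.

(** * Bounds on a conditional probability *)

Lemma measure0_of_integral_le0 d (T : measurableType d) (R : realType)
    (mu : measure T R) (B : set T) (h : T -> R) : measurable B ->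
  mu.-integrable B (EFin \o h) -> (forall x, B x -> 0 < h x) ->
  (\int[mu]_(x in B) (h x)%:E <= 0)%E -> mu B = 0%E.
Proof.
move=> mB ih h0 ih0.
have mh := measurable_int _ ih.
have : (\int[mu]_(x in B) `|(EFin \o h) x| = 0)%E.
  apply/eqP; rewrite eq_le integral_ge0 ?andbT//.
  rewrite (eq_integral (EFin \o h))// => x /set_mem Bx /=.
  by rewrite ger0_norm// ltW// h0.
move=> /(ae_eq_integral_abs mu mB mh) ae0.
apply/negligibleP => //; apply: negligibleS ae0 => x Bx /=.
by move=> /(_ Bx) [hx0]; have := h0 _ Bx; rewrite hx0 ltxx.
Qed.

Lemma le_measure_setD0 d (T : ringOfSetsType d) (R : realFieldType)
    (mu : {content set T -> \bar R}) (A E : set T) :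
  measurable A -> measurable E -> mu (A `\` E) = 0%E -> (mu A <= mu E)%E.
Proof.
move=> mA mE AE0; have mAE : measurable (A `\` E) by exact: measurableD.
rewrite -[leRHS]add0e -AE0; apply: le_trans (measureU2 _ mAE mE).
apply: le_measure; rewrite ?inE//; first exact: measurableU.
by move=> x Ax; have [Ex|nEx] := pselect (E x); [right|left].
Qed.

Section conditional_probability.
Context d (T : measurableType d) (R : realType) (Pr : probability T R).
Context (G : set (set T)) (A : set T) (g : T -> R).
Hypotheses (sG : sigma_algebra setT G) (Gm : G `<=` measurable).
Hypothesis gA : is_cond_prob Pr G A g.

Lemma cond_prob_preimage (I : set R) : measurable I -> G (g @^-1` I).
Proof.
by move=> mI; case: gA => gG _ _; apply: gG; exists I => //; rewrite setTI.
Qed.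

Let GD B E : G B -> G E -> G (B `\` E).
Proof.
move=> GB GE; case: (sG) => _ GC GU.
rewrite -[_ `\` _]setCK setCD -setTD; apply: (GC).
rewrite -bigcup2E; apply: GU => -[|[|i]] /=; last by case: (sG).
  by rewrite -setTD; apply: (GC).
by [].
Qed.

(** On B = {g < q} minus E, which lies in [G], the integral of q - g is positive unless B is null,
    whereas the averaged hypothesis on B makes it at most 0. Hence {g < q} lies in E up to a null
    set, for any version [g]. *)
Lemma cond_prob_lt (E : set T) (q delta : R) : G E -> (Pr E <= delta%:E)%E ->
  (forall B, G B -> B `<=` ~` E -> (q%:E * Pr B <= Pr (A `&` B))%E) ->
  (Pr [set w | (g w < q)%R] <= delta%:E)%E.
Proof.
move=> GE Ed qB; case: (gA) => _ ig gint.
have GL : G [set w | g w < q].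
  have := cond_prob_preimage (measurable_itv `]-oo, q[).
  by rewrite set_itvE.
have GB := GD GL GE; set B := _ `\` _ in GB.
have mB := Gm GB.
have igB : Pr.-integrable B (EFin \o g) by apply: integrableS ig.
have iq : Pr.-integrable B (EFin \o cst q) by exact: finite_measure_integrable_cst.
have B0 : Pr B = 0%E.
  apply: (@measure0_of_integral_le0 _ _ _ Pr B (fun x => q - g x)) => //.
  - have := integrableB mB iq igB.
    by apply: eq_integrable => // x _ /=; rewrite EFinB.
  - by move=> x [/= gq _]; rewrite subr_gt0.
  - under eq_integral do rewrite EFinB.
    rewrite integralB_EFin// integral_cst// gint// sube_le0.
    by apply: qB => // x [].
by apply: le_trans Ed; apply: le_measure_setD0 => //; exact: Gm.
Qed.

Lemma cond_prob_gt (E : set T) (r delta : R) : G E -> (Pr E <= delta%:E)%E ->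
  (forall B, G B -> B `<=` ~` E -> (Pr (A `&` B) <= r%:E * Pr B)%E) ->
  (Pr [set w | (r < g w)%R] <= delta%:E)%E.
Proof.
move=> GE Ed qB; case: (gA) => _ ig gint.
have GL : G [set w | r < g w].
  have := cond_prob_preimage (measurable_itv `]r, +oo[).
  by rewrite set_itvE.
have GB := GD GL GE; set B := _ `\` _ in GB.
have mB := Gm GB.
have igB : Pr.-integrable B (EFin \o g) by apply: integrableS ig.
have iq : Pr.-integrable B (EFin \o cst r) by exact: finite_measure_integrable_cst.
have B0 : Pr B = 0%E.
  apply: (@measure0_of_integral_le0 _ _ _ Pr B (fun x => g x - r)) => //.
  - have := integrableB mB igB iq.
    by apply: eq_integrable => // x _ /=; rewrite EFinB.
  - by move=> x [/= gq _]; rewrite subr_gt0.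
  - under eq_integral do rewrite EFinB.
    rewrite integralB_EFin// integral_cst// gint// sube_le0.
    by apply: qB => // x [].
by apply: le_trans Ed; apply: le_measure_setD0 => //; exact: Gm.
Qed.

End conditional_probability.

Lemma has_density_set1 (R : realType) (nu : set R -> \bar R) (t : R) :
  has_density nu -> nu [set t] = 0%E.
Proof. by move=> [f [_ _ ->//]]; exact: integral_set1. Qed.

(** * Coverage *)

Section coverage.
Context (R : realType) (d d' : measure_display).
Context (Omega : measurableType d) (T' : measurableType d').
Context (Pr : probability Omega R) (P : probability T' R) (n : nat).
Hypothesis n_gt0 : (0 < n)%N.
Context (Z : 'I_n.+1 -> Omega -> T').
Hypothesis mZ : forall i, measurable_fun setT (Z i).
Hypothesis Ziid : iid Pr Z P.
Context (s : T' -> R).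
Hypothesis s_meas : measurable_fun setT s.
Context (alpha delta : R).
Hypotheses (alpha01 : 0 < alpha < 1) (delta01 : 0 < delta < 1).

Let sRV : {RV P >-> R} :=
  HB.pack s (isMeasurableFun.Build _ _ _ _ s s_meas).
Let tau w := emp_quantile s alpha (first_n Z ^~ w).
Let covered := [set w | s (Z ord_max w) <= tau w].
Let gamma := gamma_n n alpha delta.
Let G := g_sigma_preimage (first_n Z).

Let msI (I : set R) : measurable I -> measurable (s @^-1` I).
Proof. by move=> mI; rewrite -[X in measurable X]setTI; exact: s_meas. Qed.

Let mZW i (W : set T') : measurable W -> measurable (Z i @^-1` W).
Proof. by move=> mW; rewrite -[X in measurable X]setTI; exact: mZ. Qed.

Let PrZ W : measurable W -> Pr (Z ord_max @^-1` W) = P W.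
Proof. exact: (Ziid.2 ord_max). Qed.

(* The test score enters the event only through comparisons with the sample
   scores, so measurability reduces to finitely many pairwise comparisons. *)
Lemma covered_measurable : measurable covered.
Proof.
(* Pairing each sample point with the test point turns the random threshold into a fixed set of
   pairs. *)
pose Z2 i w := (first_n Z i w, Z ord_max w).
have -> : covered = ~` [set w | 1 - alpha <=
    empirical R (Z2 ^~ w) [set pp | s pp.1 < s pp.2]].
  have E2 w : empirical R (Z2 ^~ w) [set pp | s pp.1 < s pp.2] =
      empirical R (first_n Z ^~ w) [set p | s p < s (Z ord_max w)] by [].
  apply/seteqP; split => w /=; rewrite E2.
    by move=> cov /(emp_quantile_lt _ _ _ n_gt0 alpha01); rewrite ltNge cov.
  move=> nE; rewrite /covered/= leNgt; apply/negP.
  by move=> /(emp_quantile_lt _ _ _ n_gt0 alpha01).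
apply: measurableC; apply: empirical_ge_measurable => i.
rewrite -[X in measurable X]setTI.
have := @measurable_realfun.measurable_fun_ltr _ _ R setT (s \o first_n Z i) (s \o Z ord_max).
move=> /(_ _ _ measurableT [set true]); apply => //.
- by apply: measurableT_comp => //; exact: mZ.
- by apply: measurableT_comp => //; exact: mZ.
Qed.

Let empirical_event_G (V : set T') (a : R) : measurable V ->
  G [set w | a <= empirical R (first_n Z ^~ w) V].
Proof.
move=> mV.
(* The measurability lemma is applied with [Omega] carrying only the sample sigma-algebra. *)
have := @empirical_ge_measurable R n _ (g_sigma_algebraType
  (\big[setU/set0]_(i < n) preimage_set_system setT (first_n Z i) measurable))
  T' (first_n Z) V a.
apply=> i; apply: sub_sigma_algebra; rewrite (bigD1 i)//=; left.
by exists V => //; rewrite setTI.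
Qed.

Context (g : Omega -> R).
Hypothesis gcov : is_cond_prob Pr G covered g.

Lemma coverage_lower :
  (Pr [set w | (g w < 1 - alpha - gamma)%R] <= delta%:E)%E.
Proof.
have /andP[a0 a1] := alpha01; have /andP[d0 d1] := delta01.
have [+ _] := gamma_n_root n_gt0 alpha01 delta01; rewrite -/gamma => g0.
have sG : sigma_algebra setT G by exact: smallest_sigma_algebra.
have Gm := g_sigma_preimage_first_n_measurable mZ.
(* At a nonpositive level there may be no quantile, but the bound is trivial and the exceptional
   event can be empty. *)
have [q0|q0] := leP (1 - alpha - gamma) 0.
  apply: (cond_prob_lt sG Gm gcov (E := set0)).
  - by case: sG.
  - by rewrite measure0 lee_fin ltW.
  - move=> B _ _; apply: le_trans (measure_ge0 _ _).
    by rewrite mule_le0_ge0// lee_fin.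
have [|t [tq qt]] := @quantile_exists _ _ R P sRV (1 - alpha - gamma).
  by rewrite q0/=; lra.
have mV : measurable (s @^-1` `]-oo, t[) by exact: msI.
apply: (cond_prob_lt sG Gm gcov
  (E := [set w | 1 - alpha <= empirical R (first_n Z ^~ w) (s @^-1` `]-oo, t[)])).
- exact: empirical_event_G.
- have mZ1 i : measurable_fun setT (first_n Z i) by exact: mZ.

  exact: (empirical_bernstein mZ1 (iid_first_n Ziid) mV).
- move=> B GB BE; have mB := Gm _ GB.
  have mW : measurable (s @^-1` `]-oo, t]) by exact: msI.
  (* Off the exceptional event the empirical quantile is at least [t], so a test score at most [t]
     is covered. *)
  apply: (@le_trans _ _ (Pr (B `&` Z ord_max @^-1` (s @^-1` `]-oo, t])))).
    rewrite (g_sigma_preimage_first_n_independent mZ Ziid GB)// muleC.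
    by apply: lee_wpmul2l => //; rewrite PrZ.
  apply: le_measure; rewrite ?inE.
  + exact: measurableI (mZW _ mW).
  + exact: measurableI covered_measurable mB.
  + move=> w [Bw]; rewrite /= in_itv/= => st; split=> //.
    rewrite /covered/=; apply: (le_trans st); rewrite leNgt; apply/negP.
    move=> /(emp_quantile_lt _ _ _ n_gt0 alpha01) E; apply: (BE w Bw).
    by rewrite /= set_itvE.
Qed.

Lemma coverage_upper : (forall t, P (s @^-1` [set t]) = 0%E) ->
  (Pr [set w | (1 - alpha + gamma < g w)%R] <= delta%:E)%E.
Proof.
move=> s_atomless.
have /andP[a0 a1] := alpha01; have /andP[d0 d1] := delta01.
have [+ _] := gamma_n_root n_gt0 alpha01 delta01; rewrite -/gamma => g0.
have sG : sigma_algebra setT G by exact: smallest_sigma_algebra.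
have Gm := g_sigma_preimage_first_n_measurable mZ.
have [r1|r1] := leP 1 (1 - alpha + gamma).
  apply: (cond_prob_gt sG Gm gcov (E := set0)).
  - by case: sG.
  - by rewrite measure0 lee_fin ltW.
  - move=> B GB _; have mB := Gm _ GB; apply: (@le_trans _ _ (Pr B)).
      apply: le_measure; rewrite ?inE//.
      exact: measurableI covered_measurable mB.
    by rewrite -[leLHS]mul1e lee_wpmul2r.
have [|t [tr rt]] := @quantile_exists _ _ R P sRV (1 - alpha + gamma).
  by rewrite r1 andbT; lra.
have mW : measurable (s @^-1` `]-oo, t]) by exact: msI.
have mV : measurable (~` (s @^-1` `]-oo, t])) by exact: measurableC.
have Wr : (P (s @^-1` `]-oo, t]) <= (1 - alpha + gamma)%:E)%E.
  have -> : s @^-1` `]-oo, t] = (s @^-1` `]-oo, t[) `|` (s @^-1` [set t]).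
    by rewrite -preimage_setU setUitv1.
  apply: (@le_trans _ _ (P (s @^-1` `]-oo, t[) + P (s @^-1` [set t]))%E).
    by apply: measureU2; exact: msI.
  by rewrite s_atomless adde0.
have a01' : 0 < 1 - alpha < 1 by lra.
(* The threshold 1 - (1 - alpha) is kept unsimplified to match the deviation bound at the level 1 -
   alpha. *)
apply: (cond_prob_gt sG Gm gcov (E := [set w | 1 - (1 - alpha) <=
    empirical R (first_n Z ^~ w) (~` (s @^-1` `]-oo, t]))])).
- exact: empirical_event_G.
- have mZ1 i : measurable_fun setT (first_n Z i) by exact: mZ.
  apply: (empirical_bernstein mZ1 (iid_first_n Ziid) mV) => //.
  rewrite gamma_nC -/gamma probability_setC//.
  rewrite (_ : 1 - _ - _ = 1 - (1 - alpha + gamma)); last by ring.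
  by rewrite EFinB leeB.
- move=> B GB BE; have mB := Gm _ GB.
  apply: (@le_trans _ _ (Pr (B `&` Z ord_max @^-1` (s @^-1` `]-oo, t])))); last first.
    rewrite (g_sigma_preimage_first_n_independent mZ Ziid GB)// muleC.
    by apply: lee_wpmul2r => //; rewrite PrZ.
  apply: le_measure; rewrite ?inE.
  + exact: measurableI covered_measurable mB.
  + exact: measurableI (mZW _ mW).
  + move=> w [cov Bw]; split=> //; rewrite /= in_itv/=; apply: (le_trans cov).
    apply: emp_quantile_le => //.
    (* Here more than a fraction 1 - alpha of the sample scores is at most [t], so the empirical
       quantile is at most [t]. *)
    have /negP := BE w Bw; rewrite /= empirical_setC// -ltNge set_itvE => lt1.
    by rewrite ltW//; lra.
Qed.

End coverage.

Theorem proposition2 (R : realType) (d dX dY : measure_display)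
  (Omega : measurableType d) (TX : measurableType dX) (TY : measurableType dY)
  (Pr : probability Omega R) (P : probability (TX * TY)%type R)
  (n : nat) (n_gt0 : (0 < n)%N)
  (X : 'I_n.+1 -> {RV Pr >-> TX}) (Y : 'I_n.+1 -> {RV Pr >-> TY})
  (XY_iid : iid Pr (fun (i : 'I_n.+1) (w : Omega) => (X i w, Y i w)) P)
  (s : TX * TY -> R) (s_meas : measurable_fun setT s)
  (alpha delta : R)
  (alpha01 : 0 < alpha < 1) (delta01 : 0 < delta < 1) :
  let Z := fun (i : 'I_n.+1) (w : Omega) => (X i w, Y i w) in
  let S := fun (i : 'I_n.+1) (w : Omega) => s (Z i w) in
  let sample := fun (w : Omega) => first_n (fun i => Z i w) in
  let covered := [set w : Omega |
        conf_set s alpha (sample w) (X ord_max w) (Y ord_max w)] in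
  let gamma := gamma_n n alpha delta in
  gamma <= 8 * ln (1 / delta) / (3 * n%:R)
           + Num.sqrt (2 * alpha * (1 - alpha) / n%:R * ln (1 / delta))
  /\
  forall g : Omega -> R,
    is_cond_prob Pr (g_sigma_preimage (first_n Z)) covered g ->
    ((1 - delta)%:E <= Pr [set w | (1 - alpha - gamma <= g w)%R])%E
    /\
    ((forall i, has_density (pushforward Pr (S i))) ->
     ((1 - 2 * delta)%:E <=
        Pr [set w | (1 - alpha - gamma <= g w <= 1 - alpha + gamma)%R])%E).
Proof.
move=> Z S sample covered gamma; split; first exact: gamma_n_le.
move=> g gcov.
have mZ i : measurable_fun setT (Z i) by exact: measurable_fun_pair.
have Gm := g_sigma_preimage_first_n_measurable mZ.
have ml := Gm _ (cond_prob_preimage gcov (measurable_itv `]-oo, (1 - alpha - gamma)[)).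
have mr := Gm _ (cond_prob_preimage gcov (measurable_itv `](1 - alpha + gamma), +oo[)).
rewrite !set_itvE in ml mr.
have lower := coverage_lower n_gt0 mZ XY_iid s_meas alpha01 delta01 gcov.
split.
  have -> : [set w | 1 - alpha - gamma <= g w] =
      ~` (g @^-1` [set x | x < 1 - alpha - gamma]).
    by apply/seteqP; split => w /=; [move/le_gtF => ->|move/negP; rewrite -leNgt].
  rewrite probability_setC// EFinB.
  exact: leeB.
move=> dens.
(* The law of any one score is the image of [P] under [s], so its density excludes atoms of that
   image. *)
have s_atomless t : P (s @^-1` [set t]) = 0%E.
  rewrite -(XY_iid.2 ord0); first exact: has_density_set1 (dens ord0).
  by rewrite -[X in measurable X]setTI; exact: s_meas.
have upper := coverage_upper n_gt0 mZ XY_iid s_meas alpha01 delta01 gcov s_atomless.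
(* A union bound over the two one-sided failures gives the 2 delta. *)
have -> : [set w | 1 - alpha - gamma <= g w <= 1 - alpha + gamma] =
    ~` (g @^-1` [set x | x < 1 - alpha - gamma] `|`
        g @^-1` [set x | 1 - alpha + gamma < x]).
  apply/seteqP; split => w /=.
    by move=> /andP[lg gr] []; rewrite ltNge ?lg ?gr.
  by move=> /not_orP[/negP + /negP]; rewrite -!leNgt => -> ->.
rewrite probability_setC; last exact: measurableU.
rewrite EFinB; apply: leeB => //.
apply: (le_trans (measureU2 _ ml mr)).
by rewrite mulr_natl mulr2n EFinD; apply: leeD.
Qed.
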